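(* Let $\beta\in[0,2)$ and $\alpha\in(0,1]$. For any real random variable $X$ with $\mathbb{E}[X]=0$, $\mathbb{E}[X^2]>0$ and $\mathbb{E}[X^4]<\infty$, $$\frac{|\mathbb{E}[|X|^\beta]|^{2/(2-\beta)}}{|\mathbb{E}[X^2]|^{\beta/(2-\beta)}}\left\{\frac{\mathbb{E}[X^4]}{|\mathbb{E}[X^2]|^2}-\alpha\,\frac{|\mathbb{E}[X^3]|^2}{|\mathbb{E}[X^2]|^3}\right\}>1-\alpha.$$ Moreover, there is a continuous function $F_{\alpha\beta}:[0,\infty)\to\mathbb{R}$, depending only on $\alpha$ and $\beta$, with $F_{\alpha\beta}(0)=1$, such that for every such $X$ which is Bernoulli, $$\frac{|\mathbb{E}[|X|^\beta]|^{2/(2-\beta)}}{|\mathbb{E}[X^2]|^{\beta/(2-\beta)}}\left\{\frac{\mathbb{E}[X^4]}{|\mathbb{E}[X^2]|^2}-\alpha\,\frac{|\mathbb{E}[X^3]|^2}{|\mathbb{E}[X^2]|^3}\right\}=F_{\alpha\beta}\!\left(\frac{|\mathbb{E}[X^3]|^2}{|\mathbb{E}[X^2]|^3}\right).$$ If $\beta\in(1,2)$, then $F_{\alpha\beta}(\infty):=\lim_{y\to\infty}F_{\alpha\beta}(y)=1-\alpha$.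
   Context: A random variable $X$ is called Bernoulli if the support of (the law of) $X$ consists of exactly two points. For $\beta=0$ the convention $0^0=1$ is used in $|X|^\beta$. *)

(* Defs.v *)
From mathcomp Require Import all_boot all_order all_algebra.
From mathcomp Require Import all_classical all_reals all_analysis.
Import Order.TTheory GRing.Theory Num.Theory.
Import numFieldNormedType.Exports.

Set Implicit Arguments.
Unset Strict Implicit.
Unset Printing Implicit Defensive.

Local Open Scope classical_set_scope.
Local Open Scope ring_scope.

Definition msupport (R : realType) (mu : set R -> \bar R) : set R :=
  [set x | forall U : set R, open U -> U x -> (0 < mu U)%E].

Definition bernoulli_rv (d : measure_display) (T : measurableType d)
    (R : realType) (P : probability T R) (X : {RV P >-> R}) : Prop :=
  exists a b : R, a != b /\ msupport (distribution P X) = [set a; b].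

Definition centered_L4 (d : measure_display) (T : measurableType d)
    (R : realType) (P : probability T R) (X : {RV P >-> R}) : Prop :=
  [/\ ('E_P[X] = 0)%E,
      (0 < 'E_P[fun t => (X t ^+ 2)%R])%E &
      ('E_P[fun t => (X t ^+ 4)%R] < +oo)%E].

(* [fine] sends infinite values to 0; under [centered_L4] the expectations
   below are finite for [k <= 4] and [0 <= b <= 4]. *)
Definition moment (d : measure_display) (T : measurableType d)
    (R : realType) (P : probability T R) (X : {RV P >-> R}) (k : nat) : R :=
  fine 'E_P[fun t => (X t ^+ k)%R]%E.

(* [0 `^ 0 = 1], so [abs_moment X 0 = 1] even if [X] has an atom at 0. *)
Definition abs_moment (d : measure_display) (T : measurableType d)
    (R : realType) (P : probability T R) (X : {RV P >-> R}) (b : R) : R :=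
  fine 'E_P[fun t => (`|X t| `^ b)%R]%E.

Definition skewness2 (d : measure_display) (T : measurableType d)
    (R : realType) (P : probability T R) (X : {RV P >-> R}) : R :=
  `|moment X 3| ^+ 2 / `|moment X 2| ^+ 3.

Definition pearson_functional (d : measure_display) (T : measurableType d)
    (R : realType) (P : probability T R) (alpha beta : R)
    (X : {RV P >-> R}) : R :=
  `|abs_moment X beta| `^ (2 / (2 - beta)) /
    `|moment X 2| `^ (beta / (2 - beta)) *
  (moment X 4 / `|moment X 2| ^+ 2 - alpha * skewness2 X).

(* Main.v *)
Require Import Defs.
From mathcomp Require Import all_boot all_order all_algebra.
From mathcomp Require Import all_classical all_reals all_analysis.
From mathcomp Require Import measurable_realfun ring lra.
Import Order.TTheory GRing.Theory Num.Theory.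
Import numFieldNormedType.Exports.

Local Open Scope classical_set_scope.
Local Open Scope ring_scope.

(** Write [m_k = E X^k], [A = E|X|^beta], [s = m_3^2 / m_2^3],
    [k = m_4 / m_2^2] and [K = A^(2/(2-beta)) / m_2^(beta/(2-beta))], so that
    the functional is [K (k - alpha s)].

    Two classical inequalities give the bound. Pearson's inequality
    [1 + s <= k] ([pearson_inequality], [kurtosis_ge]) is the nonnegativity of
    the expected square of a quadratic polynomial in [X]. Hoelder's inequality
    between the exponents [beta < 2 < 4] ([moment2_interpolation]) says exactly
    that [1 <= K k]. Hence
      [K (k - alpha s) = (1 - alpha) K k + alpha K (k - s)
                      >= (1 - alpha) + alpha K > 1 - alpha],
    and the inequality is strict because [K > 0].

    When the support of [X] is [{a, b}], the law lives on [{a, b}] because the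
    complement of a support is null ([negligible_setC_msupport]). Every
    function then agrees almost surely with an affine function of [X], and
    [E X = 0] determines all expectations from [a] and [b]
    ([mean_two_point]); in particular [m_2 = - a b > 0], so [a] and [b] have
    opposite signs. Up to exchanging them, [|a| = w^2 |b|] with [0 < w <= 1].
    The functional is scale invariant, hence depends on [w] alone
    ([ratio_profile], [two_point_profile]), while [s = (1/w - w)^2], a relation
    that can be solved for [w] ([skew_ratio]). So [F] is [ratio_profile]
    composed with [skew_ratio]. The value [s = 0] corresponds to [w = 1], and
    [s -> +oo] to [w -> 0+]; in the latter limit [w^(2 (beta - 1))] tends to 0
    when [beta > 1], and [F] tends to [1 - alpha]. *)

Set Implicit Arguments.
Unset Strict Implicit.
Unset Printing Implicit Defensive.

(** * Moments of a centered variable with finite fourth moment *)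

Lemma Rintegral_lincomb (d : measure_display) (T : measurableType d)
    (R : realType) (mu : {measure set T -> \bar R}) (f g : T -> R) (r s : R) :
  mu.-integrable setT (EFin \o f) -> mu.-integrable setT (EFin \o g) ->
  mu.-integrable setT (EFin \o (fun t => r * f t + s * g t)) /\
  \int[mu]_t (r * f t + s * g t) =
    r * (\int[mu]_t f t) + s * (\int[mu]_t g t).
Proof.
move=> fi gi.
have rfi : mu.-integrable setT (EFin \o (fun t => r * f t)).
  by apply: eq_integrable (integrableZl _ r fi) => // t _; rewrite /= EFinM.
have sgi : mu.-integrable setT (EFin \o (fun t => s * g t)).
  by apply: eq_integrable (integrableZl _ s gi) => // t _; rewrite /= EFinM.
split; first exact: eq_integrable (integrableD _ rfi sgi).
by rewrite RintegralD// !RintegralZl.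
Qed.

Section fourth_moment.
Context (d : measure_display) (T : measurableType d) (R : realType)
  (P : probability T R) (X : {RV P >-> R}).
Hypothesis X4 : centered_L4 X.

Let integrable_expr4 : P.-integrable setT (EFin \o (fun t => X t ^+ 4)).
Proof.
have [_ _ X4fin] := X4.
apply/integrableP; split.
  by apply/measurable_EFinP; exact: measurable_funX.
move: X4fin; rewrite unlock; apply: le_lt_trans.
rewrite le_eqVlt; apply/orP; left; apply/eqP.
by apply: eq_integral => t _ /=; rewrite ger0_norm// exprn_even_ge0.
Qed.

(** All integrability below comes from domination by [1 + X^4]. *)
Lemma integrable_le_expr4 (g : R -> R) : measurable_fun setT g ->
    (forall x, `|g x| <= 1 + x ^+ 4) ->
  P.-integrable setT (EFin \o (g \o X)).
Proof.
move=> mg gX4.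
have i1 : P.-integrable setT (EFin \o (fun=> 1)).
  exact: finite_measure_integrable_cst.
have [+ _] := Rintegral_lincomb 1 1 i1 integrable_expr4.
apply: le_integrable => //.
  by apply/measurable_EFinP; exact: measurableT_comp.
move=> t _ /=; rewrite !mul1r lee_fin.
by rewrite (le_trans (gX4 (X t)))// ler_norm.
Qed.

Lemma integrable_expr (k : nat) : (k <= 4)%N ->
  P.-integrable setT (EFin \o (fun t => X t ^+ k)).
Proof.
move=> k4; apply: (@integrable_le_expr4 (fun x => x ^+ k)).
  exact: measurable_funX.
move=> x; rewrite normrX -(ger0_norm (exprn_even_ge0 x (isT : ~~ odd 4))).
rewrite normrX; have [x1|/ltW x1] := leP `|x| 1.
  by rewrite (le_trans (exprn_ile1 k (normr_ge0 x) x1))// lerDl exprn_ge0.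
by rewrite (le_trans (ler_weXn2l x1 k4))// lerDr.
Qed.

Lemma integrable_powR_norm (b : R) : 0 <= b <= 4 ->
  P.-integrable setT (EFin \o (fun t => `|X t| `^ b)).
Proof.
move=> /andP[b0 b4]; apply: (@integrable_le_expr4 (fun x => `|x| `^ b)).
  exact: (measurableT_comp (measurable_powR b) (@normr_measurable R setT)).
move=> x; rewrite -(ger0_norm (exprn_even_ge0 x (isT : ~~ odd 4))).
rewrite (ger0_norm (powR_ge0 _ _)) normrX.
have [x1|/ltW x1] := leP `|x| 1.
  rewrite (@le_trans _ _ (1 `^ b))//.
    by apply: ge0_ler_powR => //; rewrite nnegrE.
  by rewrite powR1 lerDl exprn_ge0.
by rewrite -powR_mulrn// (le_trans (ler_powR x1 b4))// lerDr.
Qed.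

Lemma momentE (k : nat) : moment X k = \int[P]_t (X t ^+ k).
Proof. by rewrite /moment unlock. Qed.

Lemma abs_momentE (b : R) : abs_moment X b = \int[P]_t (`|X t| `^ b).
Proof. by rewrite /abs_moment unlock. Qed.

Lemma moment0 : moment X 0 = 1.
Proof.
by rewrite /moment (_ : (fun t => X t ^+ 0) = cst 1) ?expectation_cst.
Qed.

Lemma moment1 : moment X 1 = 0.
Proof.
case: X4 => EX0 _ _.
by rewrite /moment (_ : (fun t => X t ^+ 1) = X) ?EX0.
Qed.

Lemma moment2_gt0 : 0 < moment X 2.
Proof.
case: X4 => _ EX2 _; rewrite -lte_fin /moment fineK//.
by rewrite unlock integrable_fin_num// integrable_expr.
Qed.

Lemma abs_moment_ge0 b : 0 <= abs_moment X b.
Proof. by rewrite abs_momentE Rintegral_ge0// => t _; exact: powR_ge0. Qed.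

(** If [E|X|^b] vanished, [X] would be null almost surely, contradicting
    [0 < E X^2]. *)
Lemma abs_moment_gt0 b : 0 <= b <= 4 -> 0 < abs_moment X b.
Proof.
move=> b04; rewrite lt_neqAle abs_moment_ge0 andbT eq_sym.
apply/eqP => A0; have /eqP := lt0r_neq0 moment2_gt0; apply.
have X0 : ae_eq P setT (fun t => (`|X t| `^ b)%:E) (cst 0%E).
  have /integrableP[mXb _] := integrable_powR_norm b04.
  apply/(ae_eq_integral_abs _ measurableT mXb).
  transitivity (\int[P]_t (`|X t| `^ b)%:E)%E.
    by apply: eq_integral => t _ /=; rewrite ger0_norm ?powR_ge0.
  rewrite -[LHS]fineK ?integrable_fin_num ?integrable_powR_norm//.
  by congr EFin; rewrite -[RHS]A0 abs_momentE.
have iX2 := @integrable_expr 2 isT.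
rewrite momentE /Rintegral (@ae_eq_integral _ _ _ P setT (cst 0%E))//.
- by rewrite integral0.
- by case/integrableP : iX2.
- apply: filterS X0 => t /= Xt0 _.
  by have [/powR_eq0_eq0/normr0_eq0 ->] := Xt0 I; rewrite expr0n.
Qed.

(** Pearson's inequality. The polynomial [m2 x^2 - m3 x - m2^2] vanishes at
    both atoms of a centered two-point law with second and third moments [m2]
    and [m3]; the expectation of its square is
    [m2 * (m2 * (m4 - m2^2) - m3^2)]. *)
Lemma pearson_inequality :
  moment X 3 ^+ 2 <= moment X 2 * (moment X 4 - moment X 2 ^+ 2).
Proof.
set m2 := moment X 2; set m3 := moment X 3; set m4 := moment X 4.
(* the coefficients of [(m2 x^2 - m3 x - m2^2)^2], by increasing degree *)
pose c (k : nat) : R := [:: m2 ^+ 4; m2 ^+ 2 * m3 *+ 2;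
  m3 ^+ 2 - m2 ^+ 3 *+ 2; - (m2 * m3 *+ 2); m2 ^+ 2]`_k.
have [i01 E01] := Rintegral_lincomb (c 0) (c 1)
  (@integrable_expr 0 isT) (@integrable_expr 1 isT).
have [i02 E02] := Rintegral_lincomb 1 (c 2) i01 (@integrable_expr 2 isT).
have [i03 E03] := Rintegral_lincomb 1 (c 3) i02 (@integrable_expr 3 isT).
have [i04 E04] := Rintegral_lincomb 1 (c 4) i03 (@integrable_expr 4 isT).
rewrite E03 E02 E01 -!momentE moment0 moment1 -/m2 -/m3 -/m4 in E04.
rewrite -subr_ge0 -(pmulr_rge0 _ moment2_gt0) -/m2.
rewrite [leRHS](_ : _ =
  \int[P]_t ((m2 * X t ^+ 2 - m3 * X t - m2 ^+ 2) ^+ 2)).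
  by apply: Rintegral_ge0 => t _; exact: sqr_ge0.
transitivity (\int[P]_t
    (1 * (1 * (1 * (c 0 * X t ^+ 0 + c 1 * X t ^+ 1) + c 2 * X t ^+ 2)
      + c 3 * X t ^+ 3) + c 4 * X t ^+ 4)).
  by rewrite E04 /c/=; ring.
by apply: eq_Rintegral => t _; rewrite /c/=; ring.
Qed.

(** Hoelder's inequality, obtained by integrating Young's inequality for the
    normalized functions [|X|^b / E|X|^b] and [X^4 / E X^4]. *)
Lemma moment2_interpolation (b : R) : 0 <= b < 2 ->
  moment X 2 <=
    abs_moment X b `^ (2 / (4 - b)) * moment X 4 `^ ((2 - b) / (4 - b)).
Proof.
move=> /andP[b0 b2].
have b4 : 0 < 4 - b by lra.
have b04 : 0 <= b <= 4 by apply/andP; split => //; lra.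
have A0 := abs_moment_gt0 b04.
have m20 := moment2_gt0.
have m40 : 0 < moment X 4.
  have := le_trans (sqr_ge0 _) pearson_inequality.
  rewrite pmulr_rge0// subr_ge0; apply: lt_le_trans.
  by rewrite exprn_gt0.
set A := abs_moment X b in A0 *; set m4 := moment X 4 in m40 *.
(* [2 = b * th + 4 * th'] with [th + th' = 1]: the exponents are forced *)
set th := 2 / (4 - b); set th' := (2 - b) / (4 - b).
have th0 : 0 < th by rewrite divr_gt0.
have th'0 : 0 < th' by rewrite divr_gt0// subr_gt0.
have thD : th + th' = 1 by rewrite /th /th'; field; rewrite lt0r_neq0.
set C := A `^ th * m4 `^ th'.
have C0 : 0 < C by rewrite mulr_gt0// powR_gt0.
have [iE EE] := Rintegral_lincomb (th / A) (th' / m4)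
  (integrable_powR_norm b04) (@integrable_expr 4 isT).
rewrite -abs_momentE -momentE -/A -/m4 in EE.
rewrite !mulfVK ?lt0r_neq0// thD in EE.
have [iX2 EX2] := Rintegral_lincomb C^-1 0 (@integrable_expr 2 isT)
  (@integrable_expr 2 isT).
rewrite -momentE mul0r addr0 in EX2.
rewrite -[leRHS]mulr1 -ler_pdivrMl//.
rewrite -[leLHS]EX2 -[leRHS]EE; apply: le_Rintegral => //= t _.
rewrite mul0r addr0.
have := @conjugate_powR R ((`|X t| `^ b / A) `^ th) ((X t ^+ 4 / m4) `^ th')
  th^-1 th'^-1 (powR_ge0 _ _) (powR_ge0 _ _).
rewrite !invr_gt0 !invrK => /(_ th0 th'0 thD).
have X40 : 0 <= X t ^+ 4 by rewrite exprn_even_ge0.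
rewrite -!powRrM !divff ?lt0r_neq0//.
rewrite !powRr1 ?divr_ge0 ?powR_ge0 ?(ltW A0) ?(ltW m40)//.
have -> : th / A * `|X t| `^ b + th' / m4 * X t ^+ 4 =
  `|X t| `^ b / A * th + X t ^+ 4 / m4 * th' by ring.
apply: le_trans; rewrite le_eqVlt; apply/orP; left; apply/eqP.
have -> : X t ^+ 4 = `|X t| `^ 4%:R.
  by rewrite powR_mulrn// -normrX ger0_norm.
rewrite !powRM ?powR_ge0 ?invr_ge0 ?(ltW A0) ?(ltW m40)//.
rewrite -[A^-1]powR_inv1 ?ltW// -[m4^-1]powR_inv1 ?ltW//.
rewrite -!powRrM !mulN1r !powRN.
rewrite mulrACA -powRD; last first.
  apply/implyP => /eqP bth.
  have : 0 <= b * th by rewrite mulr_ge0// ltW.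
  by lra.
have -> : b * th + 4%:R * th' = 2%:R.
  by rewrite /th /th'; field; rewrite lt0r_neq0.
by rewrite powR_mulrn// real_normK ?num_real// /C invfM mulrC.
Qed.

Lemma kurtosis_ge : 1 + skewness2 X <= moment X 4 / `|moment X 2| ^+ 2.
Proof.
have m20 := moment2_gt0.
rewrite /skewness2 (gtr0_norm m20) real_normK ?num_real//.
rewrite ler_pdivlMr ?exprn_gt0// -(ler_pM2r m20).
have -> : (1 + moment X 3 ^+ 2 / moment X 2 ^+ 3) *
    moment X 2 ^+ 2 * moment X 2 =
    moment X 2 ^+ 3 + moment X 3 ^+ 2.
  by field; rewrite lt0r_neq0.
have := pearson_inequality; lra.
Qed.

Lemma pearson_functional_gt (alpha beta : R) :
  0 <= beta < 2 -> 0 < alpha <= 1 ->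
  1 - alpha < pearson_functional alpha beta X.
Proof.
move=> b02 /andP[a0 a1]; have /andP[b0 b2] := b02.
have b2' : 0 < 2 - beta by rewrite subr_gt0.
have A0 : 0 < abs_moment X beta by apply: abs_moment_gt0 => //; lra.
have m20 := moment2_gt0.
have s0 : 0 <= skewness2 X by rewrite divr_ge0// exprn_ge0.
have kge := kurtosis_ge.
have int := moment2_interpolation b02.
rewrite /pearson_functional.
set K := _ `^ _ / _.
have K0 : 0 < K by rewrite divr_gt0// powR_gt0// gtr0_norm.
have m40 : 0 < moment X 4.
  have : 0 < moment X 4 / `|moment X 2| ^+ 2 by lra.
  by rewrite pmulr_lgt0// invr_gt0 exprn_gt0// gtr0_norm.
(* Hoelder's inequality raised to the power [(4 - beta) / (2 - beta)] *)
have K1 : 1 <= K * (moment X 4 / `|moment X 2| ^+ 2).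
  rewrite /K (gtr0_norm m20) (gtr0_norm A0) mulf_div.
  rewrite ler_pdivlMr ?mulr_gt0 ?powR_gt0 ?exprn_gt0// mul1r.
  rewrite -powR_mulrn ?(ltW m20)// -powRD; last first.
    by apply/implyP => _; exact: lt0r_neq0.
  have -> : beta / (2 - beta) + 2 = (4 - beta) / (2 - beta).
    by field; exact: lt0r_neq0.
  have := @ge0_ler_powR R ((4 - beta) / (2 - beta)) _ _ _ _ _ int.
  rewrite !nnegrE !mulr_ge0 ?powR_ge0 ?invr_ge0 ?(ltW m20) ?(ltW b2')//; last first.
    by lra.
  move=> /(_ isT isT isT) /le_trans; apply.
  rewrite powRM ?powR_ge0// -!powRrM.
  have -> : 2 / (4 - beta) * ((4 - beta) / (2 - beta)) = 2 / (2 - beta).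
    by field; apply/andP; split; lra.
  have -> : (2 - beta) / (4 - beta) * ((4 - beta) / (2 - beta)) = 1.
    by field; apply/andP; split; lra.
  by rewrite powRr1// ltW.
move: K1 kge; set k := moment X 4 / _; set s := skewness2 X.
move=> K1 kge.
have -> : K * (k - alpha * s) = (1 - alpha) * (K * k) + alpha * (K * (k - s)).
  by ring.
have ks : 0 < k - s by rewrite subr_gt0 (lt_le_trans _ kge)// ltrDr.
have : 0 < alpha * (K * (k - s)).
  by apply: mulr_gt0 => //; exact: mulr_gt0.
have : (1 - alpha) * 1 <= (1 - alpha) * (K * k).
  by rewrite ler_wpM2l// subr_ge0.
by rewrite mulr1; lra.
Qed.

End fourth_moment.

(** * Two-point laws *)

Section support.
Context (R : realType).

(** The line has a countable base, so the complement of the support is covered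
    by countably many null rational intervals. *)
Lemma negligible_setC_msupport (mu : {measure set R -> \bar R}) :
  mu.-negligible (~` msupport mu).
Proof.
pose J (qr : rat * rat) : set R := `]ratr qr.1, ratr qr.2[%classic.
pose N (n : nat) : set R := if unpickle n is Some qr then
  if mu (J qr) == 0%E then J qr else set0 else set0.
have N0 : mu.-negligible (\bigcup_n N n).
  apply: negligible_bigcup => n; rewrite /N.
  case: unpickle => [qr|]; last exact: negligible_set0.
  case: eqP => [I0|_]; last exact: negligible_set0.
  by apply/negligibleP => //; exact: measurable_itv.
apply: negligibleS N0 => x /existsNP[U /not_implyP[oU /not_implyP[Ux /negP]]].
rewrite -leNgt measure_le0 => /eqP U0.
have /nbhs_ballP[e /= e0 xeU] : nbhs x U by exact: open_nbhs_nbhs.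
have [q] := @rat_in_itvoo R (x - e) x ltac:(lra).
rewrite in_itv/= => /andP[q1 q2].
have [r] := @rat_in_itvoo R x (x + e) ltac:(lra).
rewrite in_itv/= => /andP[r1 r2].
have IU : J (q, r) `<=` U.
  move=> y; rewrite /J/= in_itv/= => /andP[qy yr]; apply: xeU.
  by rewrite /ball/= ltr_norml; apply/andP; split; lra.
have J0 : mu (J (q, r)) = 0%E.
  apply/eqP; rewrite -measure_le0 -U0 le_measure// inE.
    exact: measurable_itv.
  exact: open_measurable.
exists (pickle (q, r)); first exact: I.
by rewrite /N pickleK J0 eqxx /J/= in_itv/= q2 r1.
Qed.

End support.

Section bernoulli.
Context (d : measure_display) (T : measurableType d) (R : realType)
  (P : probability T R) (X : {RV P >-> R}).

Lemma ae_in_msupport : {ae P, forall t, msupport (distribution P X) (X t)}.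
Proof.
have [N [mN N0 sN]] := negligible_setC_msupport (distribution P X).
exists (X @^-1` N); split => //; last by move=> t /sN.
by rewrite -[X in measurable X]setTI; exact: measurable_funPT.
Qed.

Hypothesis X4 : centered_L4 X.
Context (a b : R).
Hypothesis ab : a != b.
Hypothesis Xab : msupport (distribution P X) = [set a; b].

(** On [{a, b}] the function [f] coincides with its affine interpolation, whose
    expectation is its value at [E X = 0]. *)
Lemma mean_two_point (f : R -> R) :
    P.-integrable setT (EFin \o (f \o X)) ->
  \int[P]_t f (X t) = (f a * b - f b * a) / (b - a).
Proof.
move=> fX; have ba : b - a != 0 by rewrite subr_eq0 eq_sym.
have [iL EL] := Rintegral_lincomb ((f b - f a) / (b - a))
  ((f a * b - f b * a) / (b - a))
  (@integrable_expr _ _ _ _ _ X4 1 isT) (@integrable_expr _ _ _ _ _ X4 0 isT).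
rewrite -!momentE (moment1 X4) moment0 in EL.
rewrite -[RHS]mulr1 -[RHS]add0r.
rewrite -[X in _ = X + _](mulr0 ((f b - f a) / (b - a))).
rewrite -[RHS]EL /Rintegral; congr fine; apply: ae_eq_integral => //.
- by have /integrableP[mf _] := fX; exact: mf.
- by have /integrableP[mL _] := iL; exact: mL.
- have := ae_in_msupport; rewrite Xab; apply: filterS => t Xt _ /=.
  by congr EFin; case: Xt => /= ->; field.
Qed.

Lemma moment_two_point (k : nat) : (k <= 4)%N ->
  moment X k = (a ^+ k * b - b ^+ k * a) / (b - a).
Proof.
move=> k4; rewrite momentE.
exact: (mean_two_point (f := fun x => x ^+ k) (integrable_expr X4 k4)).
Qed.

Lemma abs_moment_two_point (r : R) : 0 <= r <= 4 ->
  abs_moment X r = (`|a| `^ r * b - `|b| `^ r * a) / (b - a).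
Proof.
move=> r4; rewrite abs_momentE.
exact: (mean_two_point (f := fun x => `|x| `^ r)
  (integrable_powR_norm X4 r4)).
Qed.

Lemma two_point_lt0 : a * b < 0.
Proof.
have := moment2_gt0 X4; rewrite moment_two_point//.
rewrite (_ : _ / _ = - (a * b)) ?oppr_gt0//.
by field; rewrite subr_eq0 eq_sym.
Qed.

End bernoulli.

(** * The functional as a function of the skewness *)

Section profile.
Context (R : realType).
Implicit Types (alpha beta w y : R).

(** The functional at the centered law on two points of opposite signs whose
    absolute values have ratio [w^2]; [two_point_profile] is the computation.
    This form has no negative power of [w] when [1 < beta], which makes the
    limit [w -> 0+] visible. *)
Definition ratio_profile alpha beta w : R :=
  ((1 + w `^ (2 * (beta - 1))) / (1 + w ^+ 2)) `^ (2 / (2 - beta)) *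
  (w ^+ 2 + (1 - alpha) * (1 - w ^+ 2) ^+ 2).

(** The solution [w] in [(0, 1]] of [y = (1/w - w)^2], written so that its
    decay at infinity can be read off: [sqrt (y + 4) = 1/w + w] and
    [sqrt y = 1/w - w]. *)
Definition skew_ratio y : R := 2 / (Num.sqrt (y + 4) + Num.sqrt y).

Lemma skew_ratio_gt0 y : 0 <= y -> 0 < skew_ratio y.
Proof.
by move=> y0; rewrite divr_gt0// ltr_wpDr ?sqrtr_ge0// sqrtr_gt0; lra.
Qed.

Lemma skew_ratioE w : 0 < w <= 1 -> skew_ratio ((w^-1 - w) ^+ 2) = w.
Proof.
move=> /andP[w0 w1]; have w'1 : 1 <= w^-1 by rewrite invf_ge1.
rewrite /skew_ratio (_ : _ + 4 = (w^-1 + w) ^+ 2); last first.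
  by field; rewrite lt0r_neq0.
rewrite !sqrtr_sqr !ger0_norm; [|lra|lra].
by field; rewrite !lt0r_neq0//=; lra.
Qed.

Lemma powR_continuous (r w : R) : 0 < w -> {for w, continuous (@powR R ^~ r)}.
Proof.
move=> w0; apply: differentiable_continuous.
by apply/derivable1_diffP; apply: derivable_powR; rewrite in_itv/= w0.
Qed.

(** Stated with a separate limit [m] for the power of [w], since this power is
    continuous at a positive limit of [w] for every [beta], but at [w -> 0+]
    only for [1 < beta]; both cases are needed. *)
Lemma ratio_profile_cvg (Fl : set_system R) {FF : Filter Fl} (w : R -> R)
    alpha beta (l m : R) : 0 <= m ->
  w y @[y --> Fl] --> l -> w y `^ (2 * (beta - 1)) @[y --> Fl] --> m ->
  ratio_profile alpha beta (w y) @[y --> Fl] -->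
    ((1 + m) / (1 + l ^+ 2)) `^ (2 / (2 - beta)) *
    (l ^+ 2 + (1 - alpha) * (1 - l ^+ 2) ^+ 2).
Proof.
move=> m0 wl wm.
have w2 : w y ^+ 2 @[y --> Fl] --> l ^+ 2 by exact: cvgM.
have l1 : 0 < 1 + l ^+ 2 by rewrite ltr_wpDr// sqr_ge0.
have one (c : R) : (fun=> c : R) @ Fl --> c by exact: cvg_cst.
apply: cvgM; last first.
  by apply: cvgD => //; apply: cvgM => //; apply: cvgM; apply: cvgB.
apply: (@cvg_comp _ _ _ _ (@powR R ^~ _) _ (nbhs ((1 + m) / (1 + l ^+ 2)))).
  apply: cvgM; first exact: cvgD.
  by apply: cvgV; [exact: lt0r_neq0|exact: cvgD].
by apply: powR_continuous; rewrite divr_gt0// ltr_wpDr.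
Qed.

Lemma skew_ratio_continuous y : 0 <= y -> {for y, continuous skew_ratio}.
Proof.
move=> y0; apply: cvgM; first exact: cvg_cst.
apply: cvgV; first by rewrite lt0r_neq0// ltr_wpDr ?sqrtr_ge0// sqrtr_gt0; lra.
apply: cvgD; last exact: sqrt_continuous.
apply: (@cvg_comp _ _ _ (fun y => y + 4) Num.sqrt _ (nbhs (y + 4))).
  by apply: cvgD => //; exact: cvg_cst.
exact: sqrt_continuous.
Qed.

(** A right-sided limit, because [w `^ r] tends to 0 only as [w -> 0+]: on
    negative numbers [powR] takes the value 1. *)
Lemma cvg_skew_ratio : skew_ratio y @[y --> +oo] --> 0^'+.
Proof.
move=> A /nbhs_ballP[e /= e0 eA].
suff : \forall y \near +oo, A (skew_ratio y) by [].
near=> y.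
have y0 : 0 < y by near: y; apply: nbhs_pinfty_gt; exact: num_real.
have ye : (2 / e) ^+ 2 < y by near: y; apply: nbhs_pinfty_gt; exact: num_real.
have w0 := skew_ratio_gt0 (ltW y0).
apply: eA => //; rewrite /ball/= sub0r normrN gtr0_norm//.
rewrite /skew_ratio ltr_pdivrMr; last first.
  by rewrite ltr_wpDr ?sqrtr_ge0// sqrtr_gt0; lra.
rewrite mulrC -ltr_pdivrMr// (@lt_le_trans _ _ (Num.sqrt y))//.
  by rewrite -(ger0_norm (ltW (divr_gt0 (ltr0n _ 2) e0))) -sqrtr_sqr ltr_sqrt.
by rewrite lerDr sqrtr_ge0.
Unshelve. all: by end_near. Qed.

Lemma ratio_profile_at1 alpha beta : ratio_profile alpha beta 1 = 1.
Proof.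
rewrite /ratio_profile powR1 expr1n divff//.
by rewrite powR1 subrr expr0n/= mulr0 addr0 mulr1.
Qed.

Lemma ratio_profile_continuous alpha beta y : 0 <= y ->
  {for y, continuous (ratio_profile alpha beta \o skew_ratio)}.
Proof.
move=> y0; apply: ratio_profile_cvg; first exact: powR_ge0.
  exact: skew_ratio_continuous.
apply: (@cvg_comp _ _ _ skew_ratio (@powR R ^~ _) _ (nbhs (skew_ratio y))).
  exact: skew_ratio_continuous.
by apply: powR_continuous; exact: skew_ratio_gt0.
Qed.

Lemma ratio_profile_cvgy alpha beta : 1 < beta ->
  ratio_profile alpha beta (skew_ratio y) @[y --> +oo] --> 1 - alpha.
Proof.
move=> b1.
have := @ratio_profile_cvg +oo _ skew_ratio alpha beta 0 0 (lexx 0).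
rewrite expr0n/= !(addr0, add0r) divr1 powR1 subr0 expr1n !mulr1 mul1r.
apply.
  by apply: (cvg_trans cvg_skew_ratio); exact: cvg_within.
apply: (@cvg_comp _ _ _ skew_ratio (@powR R ^~ _) _ 0^'+) => //.
  exact: cvg_skew_ratio.
by apply: powR_cvg0; rewrite mulr_gt0// subr_gt0.
Qed.

(** The left-hand side is the functional at the centered law on [{- u, c}]. All
    powers of [c] cancel, by scale invariance. *)
Lemma two_point_profile alpha beta (c w : R) : beta < 2 -> 0 < c -> 0 < w ->
  let u := w ^+ 2 * c in
  ((u `^ beta * c + c `^ beta * u) / (c + u)) `^ (2 / (2 - beta)) /
    (u * c) `^ (beta / (2 - beta)) *
    (((c ^+ 2 - u * c + u ^+ 2) / (u * c)) - alpha * (w^-1 - w) ^+ 2) =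
  ratio_profile alpha beta w.
Proof.
move=> b2 c0 w0 /=; have b2' : 0 < 2 - beta by rewrite subr_gt0.
have w20 : 0 < 1 + w ^+ 2 by rewrite addr_gt0// exprn_gt0.
set B := (1 + w `^ (2 * (beta - 1))) / (1 + w ^+ 2).
have B0 : 0 <= B by rewrite divr_ge0 ?addr_ge0 ?powR_ge0 ?sqr_ge0.
have -> : ((w ^+ 2 * c) `^ beta * c + c `^ beta * (w ^+ 2 * c)) /
    (c + w ^+ 2 * c) = c `^ beta * w `^ 2 * B.
  rewrite powRM ?(ltW c0) ?exprn_ge0 ?(ltW w0)//.
  rewrite -(powR_mulrn 2 (ltW w0)) -powRrM.
  have -> : w `^ (2%:R * beta) = w `^ 2 * w `^ (2 * (beta - 1)).
    by rewrite -powRD ?lt0r_neq0 ?implybT//; congr (_ `^ _); ring.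
  rewrite /B (powR_mulrn 2 (ltW w0)); field.
  by rewrite !lt0r_neq0// addr_gt0 ?mulr_gt0.
have -> : ((w ^+ 2 * c) * c) `^ (beta / (2 - beta)) =
    w `^ (2 * (beta / (2 - beta))) * (c `^ beta) `^ (2 / (2 - beta)).
  rewrite -mulrA -expr2 powRM ?sqr_ge0//.
  rewrite -(powR_mulrn 2 (ltW w0)) -(powR_mulrn 2 (ltW c0)) -!powRrM.
  by congr (_ * _ `^ _); ring.
have p0 := powR_gt0 (2 / (2 - beta)) (powR_gt0 beta c0).
have q0 := powR_gt0 (2 * (beta / (2 - beta))) w0.
rewrite /ratio_profile -/B; move: B B0 => B B0.
rewrite !powRM ?mulr_ge0 ?powR_ge0//.
have -> : (w `^ 2) `^ (2 / (2 - beta)) =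
    w ^+ 2 * w `^ (2 * (beta / (2 - beta))).
  rewrite -(powR_mulrn 2 (ltW w0)) -powRrM -powRD ?lt0r_neq0 ?implybT//.
  by congr (_ `^ _); field; exact: lt0r_neq0.
by field; rewrite !lt0r_neq0.
Qed.

End profile.

Lemma pearson_functional_bernoulli (d : measure_display)
    (T : measurableType d) (R : realType) (P : probability T R)
    (X : {RV P >-> R}) (alpha beta : R) :
  centered_L4 X -> 0 <= beta < 2 -> bernoulli_rv X ->
  pearson_functional alpha beta X =
    ratio_profile alpha beta (skew_ratio (skewness2 X)).
Proof.
move=> X4 /andP[b0 b2] [a [b [+ +]]].
(* [skew_ratio] selects the root [w <= 1], hence the choice of [a] *)
wlog ab : a b / `|a| <= `|b|.
  move=> H; have [|/ltW] := leP `|a| `|b|; first exact: H.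
  by move=> h ab; rewrite setUC; apply: H => //; rewrite eq_sym.
move=> aNb Xab.
have ab0 := two_point_lt0 X4 aNb Xab.
have bn0 : b != 0 by apply: contraTneq ab0 => ->; rewrite mulr0 ltxx.
have an0 : a != 0 by apply: contraTneq ab0 => ->; rewrite mul0r ltxx.
have c0 : 0 < `|b| by rewrite normr_gt0.
have u0 : 0 < `|a| by rewrite normr_gt0.
pose w := Num.sqrt (`|a| / `|b|).
have w0 : 0 < w by rewrite sqrtr_gt0 divr_gt0.
have aw : `|a| = w ^+ 2 * `|b|.
  by rewrite sqr_sqrtr ?divr_ge0// divfK// lt0r_neq0.
have w1 : w <= 1 by rewrite -sqrtr1 ler_sqrt// ler_pdivrMr// mul1r.
have bDa : `|b| + `|a| != 0 by rewrite lt0r_neq0// addr_gt0.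
have ba : b - a != 0 by rewrite subr_eq0 eq_sym.
have abE : a * b = - (`|a| * `|b|) by rewrite -normrM ltr0_norm// opprK.
have a2 : a ^+ 2 = `|a| ^+ 2 by rewrite real_normK ?num_real.
have b2' : b ^+ 2 = `|b| ^+ 2 by rewrite real_normK ?num_real.
have m2E : moment X 2 = `|a| * `|b|.
  rewrite (moment_two_point X4 aNb Xab)// -[RHS]opprK -abE; field.
  exact: ba.
have m3E : moment X 3 ^+ 2 = (`|a| * `|b|) ^+ 2 * (`|b| - `|a|) ^+ 2.
  have -> : moment X 3 = - (a * b) * (a + b).
    by rewrite (moment_two_point X4 aNb Xab)//; field; exact: ba.
  rewrite exprMn sqrrD a2 b2' abE; ring.
have m4E : moment X 4 =
    `|a| * `|b| * (`|b| ^+ 2 - `|a| * `|b| + `|a| ^+ 2).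
  have -> : moment X 4 = - (a * b) * (a ^+ 2 + a * b + b ^+ 2).
    by rewrite (moment_two_point X4 aNb Xab)//; field; exact: ba.
  rewrite a2 b2' abE; ring.
have AE : abs_moment X beta =
    (`|a| `^ beta * `|b| + `|b| `^ beta * `|a|) / (`|b| + `|a|).
  rewrite (abs_moment_two_point X4 aNb Xab); last by apply/andP; split; lra.
  have [bs|bs] := ltP b 0.
    have as_ : 0 < a by rewrite -(nmulr_llt0 _ bs).
    rewrite (ltr0_norm bs) (gtr0_norm as_) in bDa *.
    by field; rewrite ba bDa.
  have as_ : a <= 0.
    by rewrite -(@pmulr_lle0 _ b) ?(ltW ab0)// lt_neqAle bs eq_sym bn0.
  rewrite (ger0_norm bs) (ler0_norm as_) in bDa *.
  by field; rewrite ba.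
have sE : skewness2 X = (w^-1 - w) ^+ 2.
  rewrite /skewness2 real_normK ?num_real// m3E m2E.
  rewrite (gtr0_norm (mulr_gt0 u0 c0)) aw.
  by field; rewrite !lt0r_neq0.
rewrite /pearson_functional sE skew_ratioE ?w0//.
rewrite -(two_point_profile alpha b2 c0 w0)/= -aw -AE m2E m4E.
rewrite (ger0_norm (abs_moment_ge0 _ _)) (gtr0_norm (mulr_gt0 u0 c0)).
congr (_ * (_ - _)).
by field; rewrite !lt0r_neq0.
Qed.

Unset Implicit Arguments.

Theorem lemma3 (R : realType) (alpha beta : R)
    (hbeta : 0 <= beta < 2) (halpha : 0 < alpha <= 1) :
  (forall (d : measure_display) (T : measurableType d) (P : probability T R)
      (X : {RV P >-> R}),
    centered_L4 X -> pearson_functional alpha beta X > 1 - alpha) /\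
  (exists F : R -> R,
    [/\ {within `[0, +oo[, continuous F},
        F 0 = 1,
        (forall (d : measure_display) (T : measurableType d)
            (P : probability T R) (X : {RV P >-> R}),
          centered_L4 X -> bernoulli_rv X ->
          pearson_functional alpha beta X = F (skewness2 X)) &
        (1 < beta -> F y @[y --> +oo] --> 1 - alpha)]).
Proof.
split=> [d T P X X4|]; first exact: pearson_functional_gt.
exists (ratio_profile alpha beta \o @skew_ratio R); split.
- apply: continuous_in_subspaceT => y; rewrite inE/= in_itv/= andbT.
  exact: ratio_profile_continuous.
- have := @skew_ratioE R 1; rewrite ltr01 lexx invr1 subrr expr0n => /(_ isT).
  by move=> /= ->; exact: ratio_profile_at1.
- by move=> d T P X X4; exact: pearson_functional_bernoulli.
- exact: ratio_profile_cvgy.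
Qed.
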